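(* The graph $\Gamma_{l-i}(M_n(F_q))$ is connected, its diameter is $diam(\Gamma_{l-i}(M_n(F_q))) = 2$, and its radius is $r(\Gamma_{l-i}(M_n(F_q))) = 1$.
   Context: $q$ is a prime power, $n$ is a positive integer, $F_q$ is the finite field with $q$ elements and $M_n(F_q)$ is the ring of all $n\times n$ matrices over $F_q$. For $X \in M_n(F_q)$, $[X] = \{AX : A \in M_n(F_q)\}$ is the left ideal generated by $X$. The undirected left-ideal relation graph $\Gamma_{l-i}(M_n(F_q))$ is the simple graph with vertex set $M_n(F_q)$ in which two distinct vertices $X, Y$ are adjacent if and only if $[X] \subset [Y]$ or $[Y] \subset [X]$, where $\subset$ denotes proper containment. The distance between two vertices is the number of edges in a shortest path connecting them. The eccentricity of a vertex is its maximum distance to any vertex of the graph; the diameter and radius are respectively the maximum and minimum eccentricity over all vertices.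
   Formalization: The diameter is claimed to be 2 only when (n, q) is not (1, 2): for n = 1, q = 2 the graph is a single edge joining 0 and 1, so its diameter is 1; connectedness and radius 1 are stated in all cases. *)

(* Defs.v *)
From HB Require Import structures.
From mathcomp Require Import all_boot all_order all_algebra.

Set Implicit Arguments.
Unset Strict Implicit.
Unset Printing Implicit Defensive.

Import GRing.Theory.

(** A simple graph on a finite type [T] is given by its symmetric irreflexive
    adjacency relation [e : rel T]. *)

Definition graph_connected (T : finType) (e : rel T) : Prop :=
  forall x y : T, connect e x y.

(** Some path (without repeated vertices) with exactly [k] edges joins [x]
    to [y]: the tuple [p] lists its vertices after [x]. *)
Definition has_path (T : finType) (e : rel T) (x y : T) (k : nat) : bool :=
  [exists p : k.-tuple T,
     [&& path e x p, uniq (x :: p) & last x p == y]].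

(** A path has fewer than [#|T|] edges, so the least length is sought below
    [#|T|]. When no path exists [find] returns [#|T|], which exceeds every
    genuine distance and stands for infinity. *)
Definition gdist (T : finType) (e : rel T) (x y : T) : nat :=
  find (has_path e x y) (iota 0 #|T|).

Definition eccentricity (T : finType) (e : rel T) (x : T) : nat :=
  \max_(y : T) gdist e x y.

Definition diameter (T : finType) (e : rel T) : nat :=
  \max_(x : T) eccentricity e x.

(** Eccentricities are at most [#|T|], so the default value [#|T|] does not
    affect the minimum. *)
Definition radius (T : finType) (e : rel T) : nat :=
  \big[minn/#|T|]_(x : T) eccentricity e x.

Definition left_ideal (F : finFieldType) (n : nat) (X : 'M[F]_n) :
    {set 'M[F]_n} :=
  [set (A *m X)%R | A : 'M[F]_n].

Definition left_ideal_graph (F : finFieldType) (n : nat) : rel 'M[F]_n :=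
  fun X Y => (X != Y) &&
    ((left_ideal X \proper left_ideal Y) ||
     (left_ideal Y \proper left_ideal X)).
Arguments left_ideal_graph : clear implicits.

Fact left_ideal_graph_sym (F : finFieldType) (n : nat) :
  symmetric (left_ideal_graph F n).
Proof. by move=> X Y; rewrite /left_ideal_graph eq_sym orbC. Qed.

Fact left_ideal_graph_irr (F : finFieldType) (n : nat) :
  irreflexive (left_ideal_graph F n).
Proof. by move=> X; rewrite /left_ideal_graph eqxx. Qed.

(* Main.v *)
Require Import Defs.
From HB Require Import structures.
From mathcomp Require Import all_boot all_order all_algebra.
From mathcomp Require Import perm.

(** The zero matrix generates the zero ideal, which is properly contained in
    the ideal of every other matrix, so [0] is adjacent to all other vertices:
    its eccentricity is 1 and any two vertices are at distance at most 2.
    Distinct invertible matrices both generate the whole ring, so they are not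
    adjacent; two of them exist unless [n = 1] and [q = 2]. *)

Section Graph.

#[local] Set Implicit Arguments.
#[local] Unset Strict Implicit.

Variables (T : finType) (e : rel T).

(** The [k.+1] vertices of such a path are distinct elements of [T]. Hence every length realised by
    a path lies in the range that [gdist] searches. *)
Lemma has_path_lt_card x y k : has_path e x y k -> k < #|T|.
Proof.
case/existsP=> p /and3P[_ /card_uniqP def_k _].
by have := max_card (mem (x :: p)); rewrite def_k /= size_tuple.
Qed.

Lemma gdist_le x y k : has_path e x y k -> gdist e x y <= k.
Proof.
move=> pxy; rewrite leqNgt; apply/negP=> /(before_find 0).
by rewrite nth_iota ?add0n ?pxy // (has_path_lt_card pxy).
Qed.

Lemma has_path0 x y : has_path e x y 0 = (x == y).
Proof.
apply/existsP/eqP => [[p] | <-]; last by exists [tuple]; rewrite /= eqxx.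
by rewrite tuple0 /= => /eqP.
Qed.

Lemma has_path1 x y : has_path e x y 1 = (x != y) && e x y.
Proof.
apply/existsP/andP => [[p] | [neq_xy exy]].
  case/tupleP: p => z p; rewrite tuple0 /= andbT inE.
  by case/and3P=> exz neq_xz /eqP <-; rewrite andbT in neq_xz.
by exists [tuple y]; rewrite /= exy inE neq_xy eqxx.
Qed.

(** The bound [k <= #|T|] takes care of unreachable pairs, for which [gdist] is [#|T|]: a value
    below [k] is then below [#|T|], so the search has succeeded and that value is the length of an
    actual path. *)
Lemma gdist_ge x y k :
  k <= #|T| -> (forall j, j < k -> ~~ has_path e x y j) -> k <= gdist e x y.
Proof.
move=> le_kT noP; rewrite leqNgt; apply/negP=> lt_dk.
have lt_dT := leq_trans lt_dk le_kT.
have /(nth_find 0) : has (has_path e x y) (iota 0 #|T|).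
  by rewrite has_find size_iota.
by rewrite nth_iota // add0n; apply/negP/noP.
Qed.

Lemma card_gt1_neq (x y : T) : x != y -> 1 < #|T|.
Proof. by move=> neq_xy; apply/card_gt1P; exists x, y. Qed.

Lemma gdist_gt0 x y : x != y -> 0 < gdist e x y.
Proof.
move=> neq_xy; apply: gdist_ge; first exact/ltnW/(card_gt1_neq neq_xy).
by case=> // _; rewrite has_path0.
Qed.

Lemma gdist_gt1 x y : x != y -> ~~ e x y -> 1 < gdist e x y.
Proof.
move=> neq_xy nexy; apply: gdist_ge; first exact: (card_gt1_neq neq_xy).
by case=> [|[|//]] _; rewrite ?has_path0 // has_path1 neq_xy.
Qed.

Lemma eccentricity_gt0 x : 1 < #|T| -> 0 < eccentricity e x.
Proof.
rewrite (cardD1 x) inE => /card_gt0P[y]; rewrite !inE andbT eq_sym => neq_xy.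
by apply: leq_trans (gdist_gt0 neq_xy) _; apply: leq_bigmax.
Qed.

Lemma radius_le x : radius e <= eccentricity e x.
Proof.
rewrite /radius; have := mem_index_enum x.
(* Over any list, the minimum is at most the value at each member, whatever the default. *)
elim: (index_enum T) => // y s IHs; rewrite inE big_cons.
by case/predU1P=> [<- | /IHs]; rewrite geq_min ?leqnn // => ->; rewrite orbT.
Qed.

Lemma radius_gt0 : 1 < #|T| -> 0 < radius e.
Proof.
(* Positivity has to be checked for the default [#|T|] too, then for [minn] and for each
   eccentricity. *)
move=> T_gt1; apply: (big_ind (leq 1)) => [|m k m_gt0 k_gt0|x _].
- exact: ltnW.
- by rewrite leq_min m_gt0.
- exact: eccentricity_gt0.
Qed.

Section Dominating.

Variable z : T.
Hypotheses (e_sym : symmetric e) (e_z : forall y, y != z -> e z y).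

Lemma dominating_connected : graph_connected e.
Proof.
have cz x : connect e z x.
  by have [-> // | /e_z/connect1] := eqVneq x z.
move=> x y; apply: connect_trans (cz y).
by have [-> // | /e_z] := eqVneq x z; rewrite e_sym => /connect1.
Qed.

Lemma gdist_dominating y : gdist e z y <= 1.
Proof.
have [-> | neq_yz] := eqVneq y z.
  by apply: leq_trans (gdist_le (k := 0) _) _; rewrite ?has_path0.
by apply: gdist_le; rewrite has_path1 eq_sym neq_yz e_z.
Qed.

(** The walk from [x] through [z] to [y] has length 2, but [has_path] wants distinct vertices, so
    coincidences among [x], [y], [z] are split off first. *)
Lemma gdist_le2 x y : gdist e x y <= 2.
Proof.
have [-> | neq_xz] := eqVneq x z; first exact: leqW (gdist_dominating y).
have exz : e x z by rewrite e_sym e_z.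
have [-> | neq_yz] := eqVneq y z.
  by apply: leqW; apply: gdist_le; rewrite has_path1 neq_xz.
have [<- | neq_xy] := eqVneq x y.
  by apply: leq_trans (gdist_le (k := 0) _) _; rewrite ?has_path0.
apply: gdist_le; apply/existsP; exists [tuple z; y].
by rewrite /= exz e_z // !inE negb_or neq_xz neq_xy eq_sym neq_yz eqxx.
Qed.

Lemma radius_dominating : 1 < #|T| -> radius e = 1.
Proof.
move=> T_gt1; apply/eqP; rewrite eqn_leq radius_gt0 // andbT.
apply: leq_trans (radius_le z) _.
by apply/bigmax_leqP => y _; apply: gdist_dominating.
Qed.

Lemma diameter_dominating x y : x != y -> ~~ e x y -> diameter e = 2.
Proof.
move=> neq_xy nexy; apply/eqP; rewrite eqn_leq; apply/andP; split.
  by apply/bigmax_leqP=> u _; apply/bigmax_leqP=> v _; apply: gdist_le2.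
apply: leq_trans (gdist_gt1 neq_xy nexy) _.
apply: (@leq_trans (eccentricity e x)); first exact: leq_bigmax.
exact: (leq_bigmax (F := eccentricity e)).
Qed.

End Dominating.

End Graph.

Section LeftIdeals.

Variables (F : finFieldType) (n : nat).
Implicit Types X Y : 'M[F]_n.

Import GRing.Theory.
Local Open Scope ring_scope.

Lemma mem_left_ideal X : X \in left_ideal X.
Proof. by apply/imsetP; exists 1%:M; rewrite ?mul1mx. Qed.

Lemma left_ideal0 : left_ideal (0 : 'M[F]_n) = [set 0].
Proof.
apply/setP=> Y; rewrite inE; apply/imsetP/eqP => [[A _ ->] | ->].
  by rewrite mulmx0.
by exists 0; rewrite ?mulmx0.
Qed.

Lemma left_ideal_unitmx X : X \in unitmx -> left_ideal X = [set: 'M[F]_n].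
Proof.
move=> uX; apply/setP=> Y; rewrite inE; apply/imsetP.
by exists (Y *m invmx X); rewrite ?mulmxKV.
Qed.

Lemma left_ideal_graph0 X : X != 0 -> left_ideal_graph F n 0 X.
Proof.
move=> nzX; rewrite /left_ideal_graph eq_sym nzX left_ideal0.
rewrite properE sub1set; apply/orP; left; apply/andP; split.
  by apply/imsetP; exists 0; rewrite ?mul0mx.
by apply/subsetPn; exists X; rewrite ?mem_left_ideal // inE.
Qed.

Lemma left_ideal_graph_unitmx X Y :
  X \in unitmx -> Y \in unitmx -> ~~ left_ideal_graph F n X Y.
Proof.
move=> uX uY.
by rewrite /left_ideal_graph !left_ideal_unitmx // properxx andbF.
Qed.

(** Together with the identity, [X] will be the non-adjacent pair that forces diameter 2. In the
    excluded case the graph is a single edge, of diameter 1. *)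
Lemma unitmx_neq1 : (0 < n)%N -> ~ (n = 1%N /\ #|F| = 2) ->
  exists2 X : 'M[F]_n, X \in unitmx & X != 1%:M.
Proof.
move=> n_gt0 notF2; have [n_gt1 | n_le1] := ltnP 1 n.
  (* Swapping the first two coordinates puts a 0 in the top left corner, where the identity has a
     1. *)
  pose i := Ordinal n_gt0; pose j := Ordinal n_gt1.
  exists (tperm_mx i j); first exact: unitmx_perm.
  apply/eqP=> /matrixP/(_ i i)/eqP.
  by rewrite !mxE tpermL eqxx eq_sym oner_eq0.
have n1 : n = 1%N by apply/eqP; rewrite eqn_leq n_le1.
(* For [n = 1], a field with more than two elements has some [a] other than 0 and 1, and the scalar
   matrix of [a] is the witness. *)
have /subsetPn[a _] : ~~ ([set: F] \subset [set 0; 1]).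
  apply/negP=> /subset_leq_card; rewrite cardsT cards2 eq_sym oner_eq0 => le2.
  apply: notF2; split=> //; apply/eqP; rewrite eqn_leq le2 /=.
  exact: (card_gt1_neq (oner_neq0 F)).
rewrite !inE negb_or => /andP[nz_a neq_a1]; exists a%:M.
  by rewrite unitmxE det_scalar unitrX ?unitfE.
apply/eqP=> /matrixP/(_ (Ordinal n_gt0) (Ordinal n_gt0))/eqP.
by rewrite !mxE eqxx (negPf neq_a1).
Qed.

End LeftIdeals.

Theorem corollary4p4 (F : finFieldType) (n : nat) (n_gt0 : 0 < n) :
  [/\ graph_connected (left_ideal_graph F n),
      ~ (n = 1 /\ #|F| = 2) -> diameter (left_ideal_graph F n) = 2
    & radius (left_ideal_graph F n) = 1].
Proof.
have e0 := @left_ideal_graph0 F n; have e_sym := @left_ideal_graph_sym F n.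
split.
- exact: dominating_connected e_sym e0.
- case/(unitmx_neq1 F n n_gt0) => X uX neqX1.
  apply: (diameter_dominating e_sym e0 neqX1).
  by rewrite left_ideal_graph_unitmx ?unitmx1.
(* There are at least two vertices: as [n] is positive, 1 and 0 differ in their first diagonal
   entry. *)
- apply: radius_dominating e0 _; apply: (@card_gt1_neq _ (1%:M)%R 0%R).
  apply/eqP=> /matrixP/(_ (Ordinal n_gt0) (Ordinal n_gt0))/eqP.
  by rewrite !mxE eqxx GRing.oner_eq0.
Qed.
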